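(* Let $V$ be a continuous and concave capacity on $(\Omega,\mathcal{F})$ with conjugate capacity $v$, let $\theta:\Omega\to\Omega$ be a measurable map that preserves $V$ and is ergodic with respect to $V$, and let $\xi$ be a bounded $\mathcal{F}$-measurable random variable. Then there is a constant $c$ such that $\lim_{n\to\infty}\frac1n\sum_{k=0}^{n-1}\xi(\theta^{k}\omega)=c$ quasi-surely, and $c\in\left[\int_{\Omega}\xi\, dv,\int_{\Omega}\xi\, dV\right]$.
   Context: A capacity is $V:\mathcal{F}\to[0,1]$ with $V(\emptyset)=0$, $V(\Omega)=1$, monotone. It is concave if $V(A\cup B)+V(A\cap B)\le V(A)+V(B)$ for all $A,B$, and continuous if $V(A_n)\to V(A)$ whenever $A_n\uparrow A$ or $A_n\downarrow A$. The conjugate is $v(A)=1-V(A^c)$. $\theta$ preserves $V$ if $V(\theta^{-1}A)=V(A)$ for all $A$; it is ergodic w.r.t. $V$ if for every $B$ with $\theta^{-1}B=B$: $V(B)\in\{0,1\}$, and $V(B)=0$ or $V(B^c)=0$. ''Quasi-surely'' means outside a set $A$ with $V(A)=0$. The Choquet integral is $\int_{\Omega}\xi\, d\mu=\int_{0}^{\infty}\mu(\{\xi\ge t\})\,dt+\int_{-\infty}^0[\mu(\{\xi\ge t\})-1]\,dt$. *)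

(* Defs.v *)
From HB Require Import structures.
From mathcomp Require Import all_boot all_order all_algebra.
From mathcomp Require Import all_classical all_reals all_analysis.
Set Implicit Arguments. Unset Strict Implicit. Unset Printing Implicit Defensive.
Import Order.TTheory GRing.Theory Num.Theory.
Import numFieldNormedType.Exports.
Local Open Scope classical_set_scope.
Local Open Scope ring_scope.

Section Capacities.
Context {d : measure_display} {T : measurableType d} {R : realType}.

(* A capacity on the measurable sets F of T (values outside F are irrelevant). *)
Definition is_capacity (V : set T -> R) : Prop :=
  [/\ V set0 = 0, V setT = 1,
      (forall A, measurable A -> 0 <= V A <= 1) &
      (forall A B, measurable A -> measurable B -> A `<=` B -> V A <= V B)].

Definition concave_capacity (V : set T -> R) : Prop :=
  forall A B, measurable A -> measurable B ->
    V (A `|` B) + V (A `&` B) <= V A + V B.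

Definition continuous_capacity (V : set T -> R) : Prop :=
  (forall (A : nat -> set T), (forall n, measurable (A n)) ->
     (forall n, A n `<=` A n.+1) ->
     V (A n) @[n --> \oo] --> V (\bigcup_n A n)) /\
  (forall (A : nat -> set T), (forall n, measurable (A n)) ->
     (forall n, A n.+1 `<=` A n) ->
     V (A n) @[n --> \oo] --> V (\bigcap_n A n)).

Definition conjugate (V : set T -> R) : set T -> R := fun A => 1 - V (~` A).

Definition preserves (V : set T -> R) (theta : T -> T) : Prop :=
  forall A, measurable A -> V (theta @^-1` A) = V A.

Definition ergodic (V : set T -> R) (theta : T -> T) : Prop :=
  forall B, measurable B -> theta @^-1` B = B ->
    (V B = 0 \/ V B = 1) /\ (V B = 0 \/ V (~` B) = 0).

Definition quasi_surely (V : set T -> R) (P : T -> Prop) : Prop :=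
  exists N, [/\ measurable N, V N = 0 & forall w, ~ N w -> P w].

Definition choquet (mu : set T -> R) (xi : T -> R) : \bar R :=
  (\int[lebesgue_measure]_(t in `[(0%R:R), +oo[%classic) (mu [set w | (t <= xi w)%R])%:E
   + \int[lebesgue_measure]_(t in `]-oo, (0%R:R)[%classic)
        (mu [set w | (t <= xi w)%R] - 1)%R%:E)%E.

End Capacities.

(* Main.v *)
(* By ergodicity, [limsup] and [liminf] of the averages of a bounded function
   are quasi-surely constant.  A Katznelson-Weiss covering argument needs no
   invariant measure here.  Replacing [A] by [A `|` D], with [V D] small, orbits
   visit [A `|` D] with frequency at least [limsup - e] in a uniformly bounded
   time, and submodularity turns a pointwise lower bound on the number of visits
   into one on the sum of the capacities; hence the upper frequency of visits
   to [A] is at most [V A].  Applied to the exceptional set on which the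
   averages of [xi] are slow to come close to their [liminf], this lets the
   covering argument bound the [limsup] by the [liminf].  Finally [xi] is
   bounded above by a step function in the indicators of [{xi > t}], whose
   limiting frequencies are at most [V {xi > t}], so [c] is at most a Riemann
   sum of the Choquet integral; the lower bound is the same for [- xi]. *)
Require Import Defs.
From HB Require Import structures.
From mathcomp Require Import all_boot all_order all_algebra.
From mathcomp Require Import all_classical all_reals all_analysis.
From mathcomp Require Import measurable_realfun ring lra.
Import Order.TTheory GRing.Theory Num.Theory.
Import numFieldNormedType.Exports.
Local Open Scope classical_set_scope.
Local Open Scope ring_scope.

(** * Riemann sums of the Choquet integral *)

Section RiemannSums.
Context {R : realType}.
Local Notation mu := (@lebesgue_measure R).

Section Steps.
Variables (f : R -> R) (D : set R) (s : seq nat) (h : R) (I : nat -> set R).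
Hypotheses (mD : measurable D) (mf : measurable_fun D f).
Hypothesis f0 : forall t, D t -> 0 <= f t.
Hypotheses (mI : forall j, measurable (I j)) (hI : forall j, mu (I j) = h%:E).
Hypotheses (tI : trivIset setT I) (us : uniq s).
Hypothesis ID : forall j, j \in s -> I j `<=` D.

Lemma bigsetU_steps_sub : \big[setU/set0]_(j <- s) I j `<=` D.
Proof. by move=> t; rewrite -bigcup_seq => -[j /= js Ijt]; exact: (ID _ js _ Ijt). Qed.

Lemma integral_steps :
  (\int[mu]_(t in \big[setU/set0]_(j <- s) I j) (f t)%:E
   = \sum_(j <- s) \int[mu]_(t in I j) (f t)%:E)%E.
Proof.
apply: ge0_integral_bigsetU => //.
- exact: (sub_trivIset (@subsetT _ _)).
- apply/measurable_EFinP; apply: (measurable_funS mD) => //.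
  exact: bigsetU_steps_sub.
- by move=> t /bigsetU_steps_sub Dt; rewrite lee_fin f0.
Qed.

Lemma le_steps_integral (a : nat -> R) :
  (forall j, j \in s -> 0 <= a j) ->
  (forall j t, j \in s -> I j t -> a j <= f t) ->
  ((h * \sum_(j <- s) a j)%:E <= \int[mu]_(t in D) (f t)%:E)%E.
Proof.
move=> a0 af.
apply: (@le_trans _ _ (\int[mu]_(t in \big[setU/set0]_(j <- s) I j) (f t)%:E)%E).
  rewrite integral_steps mulr_sumr -sumEFin big_seq [leRHS]big_seq.
  apply: lee_sum => j js.
  have -> : (h * a j)%:E = (\int[mu]_(t in I j) (cst (a j)%:E) t)%E.
    by rewrite EFinM muleC integral_cst; [rewrite -(hI j)|exact: mI].
  apply: (ge0_le_integral mu (mI j)) => //.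
  - by move=> t _ /=; rewrite lee_fin a0.
  - by apply/measurable_EFinP; apply: (measurable_funS mD) => //; exact: ID.
  - by move=> t It /=; rewrite lee_fin af.
have mU : measurable (\big[setU/set0]_(j <- s) I j) by exact: bigsetU_measurable.
apply: (ge0_subset_integral mu mU mD) => //.
- exact/measurable_EFinP.
- exact: bigsetU_steps_sub.
Qed.

Lemma integral_le_steps (b : nat -> R) :
  (forall j t, j \in s -> I j t -> f t <= b j) ->
  (forall t, D t -> (forall j, j \in s -> ~ I j t) -> f t = 0) ->
  (\int[mu]_(t in D) (f t)%:E <= (h * \sum_(j <- s) b j)%:E)%E.
Proof.
move=> fb fD0.
have -> : (\int[mu]_(t in D) (f t)%:E
    = \int[mu]_(t in \big[setU/set0]_(j <- s) I j) (f t)%:E)%E.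
  rewrite integral_mkcond [RHS]integral_mkcond; apply: eq_integral => t _.
  rewrite /patch; case: ifPn; rewrite (inE, notin_setE) => Dt;
    case: ifPn; rewrite (inE, notin_setE) => //.
  - rewrite -bigcup_seq => nI; rewrite fD0// => j js Ij.
    by apply: nI; exists j.
  - by move/bigsetU_steps_sub.
rewrite integral_steps mulr_sumr -sumEFin big_seq [leRHS]big_seq.
apply: lee_sum => j js.
have -> : (h * b j)%:E = (\int[mu]_(t in I j) (cst (b j)%:E) t)%E.
  by rewrite EFinM muleC integral_cst; [rewrite -(hI j)|exact: mI].
apply: (ge0_le_integral mu (mI j)) => //.
- by move=> t It; rewrite lee_fin f0//; exact: (ID _ js _ It).
- by apply/measurable_EFinP; apply: (measurable_funS mD) => //; exact: ID.
- by move=> t It /=; rewrite lee_fin fb.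
Qed.

End Steps.

(** A discrete intermediate value argument, descending from [n]; it places any point between the
    extreme nodes in a grid step. *)
Lemma step_crossing (x : nat -> R) (t : R) (m n : nat) :
  x m <= t -> t < x n -> (m <= n)%N ->
  exists2 j, (m <= j < n)%N & x j <= t < x j.+1.
Proof.
move=> xm; elim: n => [|n IH] xn mn.
  by move: mn xm; rewrite leqn0 => /eqP ->; rewrite leNgt xn.
have [mn'|nm] := leqP m n; last first.
  have E : m = n.+1 by apply/eqP; rewrite eqn_leq mn nm.
  by move: xm; rewrite E leNgt xn.
have [tn|nt] := ltP t (x n).
  by have [j /andP[mj jn] xj] := IH tn mn'; exists j; rewrite // mj ltnW.
by exists n; rewrite ?mn' ?ltnSn// nt.
Qed.

Section Choquet.
Context {d : measure_display} {T : measurableType d}.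
Variables (nu : set T -> R) (xi : T -> R) (K : R) (n : nat).
Let g (t : R) := nu [set w | t <= xi w].
Let h := K / n%:R.
(** The nodes run from [- K] at index 0 through 0 at index [n] to [K] at [n + n], so no step
    straddles 0, where the Choquet integrand changes. *)
Let x (j : nat) := - K + j%:R * h.
Hypotheses (K0 : 0 < K) (n0 : (0 < n)%N).
Hypothesis g_mono : {homo g : s t /~ t <= s}.
Hypothesis g01 : forall t, 0 <= g t <= 1.
Hypothesis g1 : forall t, t <= - K -> g t = 1.
Hypothesis g0 : forall t, K <= t -> g t = 0.

Let h0 : 0 < h. Proof. by rewrite divr_gt0// ltr0n. Qed.
Let nh : n%:R * h = K. Proof. by rewrite /h mulrCA divff ?mulr1// pnatr_eq0 -lt0n. Qed.
Let x0 : x 0 = - K. Proof. by rewrite /x mul0r addr0. Qed.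
Let xn : x n = 0. Proof. by rewrite /x nh addrC subrr. Qed.
Let x2n : x (n + n)%N = K. Proof. by rewrite /x natrD mulrDl nh; lra. Qed.
Let x_mono i j : (i <= j)%N -> x i <= x j.
Proof. by move=> ij; rewrite lerD2l ler_wpM2r ?(ltW h0)// ler_nat. Qed.

Let I (j : nat) : set R := `[x j, x j.+1[%classic.

Let mI j : measurable (I j). Proof. exact: measurable_itv. Qed.
Let hI j : mu (I j) = h%:E.
Proof.
have xS : x j.+1 - x j = h by rewrite /x -natr1; ring.
rewrite /I lebesgue_measure_itv /= lte_fin ifT; last by rewrite -subr_gt0 xS.
by rewrite -EFinB xS.
Qed.
Let tI : trivIset setT I.
Proof.
apply/trivIsetP => i j _ _ ij; rewrite -subset0 => t [].
rewrite /I /= !in_itv/= => /andP[it ti] /andP[jt tj].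
move: ij; rewrite neq_ltn => /orP[] /x_mono ij; lra.
Qed.
Let s1 := index_iota 0 n.
Let s2 := index_iota n (n + n).
Let Ds1 := (`]-oo, (0%R:R)[%classic : set R).
Let Ds2 := (`[(0%R:R), +oo[%classic : set R).
Let ID1 j : j \in s1 -> I j `<=` Ds1.
Proof.
rewrite mem_index_iota /= => jn t; rewrite /I /Ds1 /= !in_itv/= => /andP[_ tj].
by rewrite -xn; exact: (lt_le_trans tj (x_mono _ _ jn)).
Qed.
Let ID2 j : j \in s2 -> I j `<=` Ds2.
Proof.
rewrite mem_index_iota /= => /andP[nj _] t; rewrite /I /Ds2 /= !in_itv/= => /andP[jt _].
by rewrite -xn andbT; exact: (le_trans (x_mono _ _ nj)).
Qed.
Let mD1 : measurable Ds1. Proof. exact: measurable_itv. Qed.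
Let mD2 : measurable Ds2. Proof. exact: measurable_itv. Qed.
Let us1 : uniq s1. Proof. exact: iota_uniq. Qed.
Let us2 : uniq s2. Proof. exact: iota_uniq. Qed.
Let mg D : measurable D -> measurable_fun D g.
Proof. by move=> mD; exact: nonincreasing_measurable. Qed.
Let m1g D : measurable D -> measurable_fun D (fun t => 1 - g t).
Proof.
move=> mD; apply: nondecreasing_measurable => // s t st.
by rewrite lerD2l lerN2; exact: g_mono.
Qed.

(** Since [g <= 1], both integrands become nonnegative, and each half-line can be compared with
    steps separately. *)
Let choquetE : choquet nu xi =
  (\int[mu]_(t in Ds2) (g t)%:E - \int[mu]_(t in Ds1) (1 - g t)%:E)%E.
Proof.
rewrite /choquet -/g; congr (_ + _)%E.
rewrite -integral_ge0N; last first.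
  by move=> t _; rewrite lee_fin subr_ge0; case/andP: (g01 t).
by apply: eq_integral => t _; rewrite -EFinN opprB.
Qed.

(** The constants 1 on the [n] negative steps contribute [n * h = K], which accounts for the term
    [- K]. *)
Let sum_split (u : nat -> R) :
  - K + h * \sum_(j < n + n) u j =
  h * (\sum_(j <- s2) u j) - h * (\sum_(j <- s1) (1 - u j)).
Proof.
rewrite -(big_mkord xpredT u) (@big_cat_nat _ _ _ n)//= ?leq_addr//.
rewrite sumrB big_const_nat subn0 iter_addr_0 mulrDr mulrBr.
by rewrite -mulr_natl mulr1 [h * n%:R]mulrC nh; ring.
Qed.

(** Right endpoints minorise the nonincreasing [g], and the part of the positive axis beyond the
    grid only helps. On the negative axis they majorise [1 - g], which vanishes left of [- K]. *)
Lemma riemann_le_choquet :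
  ((- K + h * \sum_(j < n + n) g (x j.+1))%:E <= choquet nu xi)%E.
Proof.
rewrite (sum_split (fun j => g (x j.+1))) choquetE EFinB; apply: leeB.
- apply: (le_steps_integral _ _ _ _ _ mD2 (mg _ mD2) _ mI hI tI us2 ID2).
  + by move=> t _; case/andP: (g01 t).
  + by move=> j _; case/andP: (g01 (x j.+1)).
  + by move=> j t _; rewrite /I /= in_itv/= => /andP[_ /ltW]; exact: g_mono.
- apply: (integral_le_steps _ _ _ _ _ mD1 (m1g _ mD1) _ mI hI tI us1 ID1).
  + by move=> t _; rewrite subr_ge0; case/andP: (g01 t).
  + move=> j t _; rewrite /I /= in_itv/= => /andP[_ /ltW/g_mono].
    by rewrite lerD2l lerN2.
  + move=> t; rewrite /Ds1 /= in_itv/= => t0 nI.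
    rewrite g1 ?subrr// leNgt; apply/negP => Kt.
    have [||j jn /andP[xj xj1]] := @step_crossing x t 0 n _ _ (leq0n _).
    * by rewrite x0 ltW.
    * by rewrite xn.
    * by apply: (nI j); rewrite ?mem_index_iota// /I /= in_itv/= xj xj1.
Qed.

(** Left endpoints reverse both comparisons; now it is the vanishing of [g] beyond [K] that confines
    the integral to the grid. *)
Lemma choquet_le_riemann :
  (choquet nu xi <= (- K + h * \sum_(j < n + n) g (x j))%:E)%E.
Proof.
rewrite (sum_split (fun j => g (x j))) choquetE EFinB; apply: leeB.
- apply: (integral_le_steps _ _ _ _ _ mD2 (mg _ mD2) _ mI hI tI us2 ID2).
  + by move=> t _; case/andP: (g01 t).
  + by move=> j t _; rewrite /I /= in_itv/= => /andP[/g_mono].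
  + move=> t; rewrite /Ds2 /= in_itv/= andbT => t0 nI.
    rewrite g0// leNgt; apply/negP => Kt.
    have [||j jn /andP[xj xj1]] := @step_crossing x t n (n + n) _ _ (leq_addr _ _).
    * by rewrite xn.
    * by rewrite x2n.
    * by apply: (nI j); rewrite ?mem_index_iota// /I /= in_itv/= xj xj1.
- apply: (le_steps_integral _ _ _ _ _ mD1 (m1g _ mD1) _ mI hI tI us1 ID1).
  + by move=> t _; rewrite subr_ge0; case/andP: (g01 t).
  + by move=> j _; rewrite subr_ge0; case/andP: (g01 (x j)).
  + move=> j t _; rewrite /I /= in_itv/= => /andP[/g_mono + _].
    by rewrite lerD2l lerN2.
Qed.

End Choquet.
End RiemannSums.

(** * Upper limits of averages *)

Section Often.
Context {R : realType}.
Implicit Types (u v : nat -> R) (b c e : R).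

Lemma nat_ge (x : R) : exists n : nat, x <= n%:R.
Proof.
exists (Num.bound x); apply/ltW/(le_lt_trans (ler_norm x)).
by have := archi_boundP (normr_ge0 x); rewrite /Num.bound normr_id.
Qed.

(* The assertion [limsup u n / n > b], free of divisions. *)
Definition often u b : Prop :=
  exists2 e, 0 < e & forall m, exists2 n, (m <= n)%N & n%:R * (b + e) <= u n.

Lemma notoften u b e : ~ often u b -> 0 < e ->
  exists m, forall n, (m <= n)%N -> u n < n%:R * (b + e).
Proof.
move=> nu e0; apply: contrapT => H; apply: nu; exists e => // m.
apply: contrapT => H'; apply: H; exists m => n mn.
by rewrite ltNge; apply/negP => un; apply: H'; exists n.
Qed.

Lemma often_le u b b' : b <= b' -> often u b' -> often u b.
Proof.
move=> bb' [e e0 H]; exists e => // m; have [n mn Hn] := H m.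
by exists n => //; apply: le_trans Hn; rewrite ler_wpM2l// lerD2r.
Qed.

(** A bounded error and a shift of the index change the average by a vanishing amount, absorbed by
    half of the slack [e]. With [often_pred] this gives invariance of limsup sets. *)
Lemma often_succ u v b c :
  (forall n, u n <= v n.+1 + c) -> often u b -> often v b.
Proof.
move=> uv [e e0 H]; exists (e / 2); first by rewrite divr_gt0.
(* The goal [n.+1 * (b + e / 2) <= n * (b + e) - c] amounts to [b + e / 2 + c <= n * (e / 2)]. *)
move=> m; have [k Hk] := nat_ge ((b + e / 2 + c) / (e / 2)).
have [n mn Hn] := H (maxn m k).
move: mn; rewrite geq_max => /andP[mn kn].
exists n.+1; first exact: leqW.
have : b + e / 2 + c <= n%:R * (e / 2).
  rewrite -ler_pdivrMr ?divr_gt0//; apply: (le_trans Hk).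
  by rewrite ler_nat.
have := uv n; rewrite -(natr1 n); nra.
Qed.

Lemma often_pred u v b c :
  (forall n, u n.+1 <= v n + c) -> often u b -> often v b.
Proof.
move=> uv [e e0 H]; exists (e / 2); first by rewrite divr_gt0.
move=> m; have [k Hk] := nat_ge ((c - b - e) / (e / 2)).
have [[//|n] mn Hn] := H (maxn m k).+1.
move: mn; rewrite ltnS geq_max => /andP[mn kn].
exists n; first exact: mn.
have : c - b - e <= n%:R * (e / 2).
  rewrite -ler_pdivrMr ?divr_gt0//; apply: (le_trans Hk).
  by rewrite ler_nat.
by have := uv n; move: Hn; rewrite -(natr1 n); nra.
Qed.

Lemma often_scale u v a b k c : 0 < k ->
  (forall n, u n <= n%:R * a + k * v n + c) -> often u (a + b) ->
  often v (b / k).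
Proof.
move=> k0 uv [e e0 H]; exists (e / k / 2); first by rewrite !divr_gt0.
move=> m; have [l Hl] := nat_ge (c / (e / 2)).
have [n mn Hn] := H (maxn m l).
move: mn; rewrite geq_max => /andP[mn ln].
exists n => //.
have : c <= n%:R * (e / 2).
  rewrite -ler_pdivrMr ?divr_gt0//; apply: (le_trans Hl).
  by rewrite ler_nat.
have := uv n => Hu Hc.
rewrite -(ler_pM2l k0).
have -> : k * (n%:R * (b / k + e / k / 2)) = n%:R * (b + e / 2).
  by field; rewrite gt_eqF.
by lra.
Qed.

Lemma often_cvg u b c :
  (n%:R^-1 * u n) @[n --> \oo] --> c -> b < c -> often u b.
Proof.
move=> uc bc; exists ((c - b) / 2); first by rewrite divr_gt0// subr_gt0.
move=> m.
have : \forall n \near \oo, (b + (c - b) / 2) < n%:R^-1 * u n.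
  by apply: (cvgr_gt _ uc); lra.
(* The successor keeps the index positive, so that its inverse is a genuine one. *)
move=> [k _ Hk]; exists (maxn m k.+1); first exact: leq_maxl.
have n0 : 0 < (maxn m k.+1)%:R :> R by rewrite ltr0n (leq_trans _ (leq_maxr _ _)).
have /= := Hk (maxn m k.+1) (ltnW (leq_maxr _ _)).
by rewrite [X in _ < X -> _]mulrC ltr_pdivlMr// mulrC => /ltW.
Qed.

(** The two hypotheses say that the limsup is at most [c] and, through [- u], that the liminf is at
    least [c]. *)
Lemma cvg_notoften u c :
  (forall e, 0 < e -> ~ often u (c + e)) ->
  (forall e, 0 < e -> ~ often (fun n => - u n) (- c + e)) ->
  (n%:R^-1 * u n) @[n --> \oo] --> c.
Proof.
move=> H1 H2; apply/cvgrPdist_lt => e e0.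
have e2 : 0 < e / 2 by rewrite divr_gt0.
have [m1 Hm1] := notoften _ _ _ (H1 _ e2) e2.
have [m2 Hm2] := notoften _ _ _ (H2 _ e2) e2.
exists (maxn m1 m2).+1 => // n /=; rewrite gtn_max => /andP[n1 n2].
have n0 : 0 < n%:R :> R by rewrite ltr0n (leq_trans _ n1).
have := Hm1 n (ltnW n1); have := Hm2 n (ltnW n2) => A B.
rewrite ltr_norml -(ltr_pM2l n0) -(@ltr_pM2l _ n%:R n0 _ e) mulrBr mulrA divff ?gt_eqF//.
by apply/andP; split; lra.
Qed.

End Often.

(** * Birkhoff sums and the covering argument *)

Section BirkhoffSum.
Context {T : Type} {R : realType}.
Variable theta : T -> T.

Definition bsum (f : T -> R) (n : nat) (w : T) : R :=
  \sum_(k < n) f (iter k theta w).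

Lemma bsumD f m n w : bsum f (m + n) w = bsum f m w + bsum f n (iter m theta w).
Proof.
rewrite /bsum big_split_ord/=; congr (_ + _).
by apply: eq_bigr => i _; rewrite addnC iterD.
Qed.

Lemma bsumSl f n w : bsum f n.+1 w = f w + bsum f n (theta w).
Proof. by rewrite -add1n bsumD /bsum big_ord1. Qed.

Lemma bsum_le f g n w : (forall w, f w <= g w) -> bsum f n w <= bsum g n w.
Proof. by move=> fg; apply: ler_sum. Qed.

Lemma bsum_const (c : R) n w : bsum (fun=> c) n w = n%:R * c.
Proof. by rewrite /bsum sumr_const card_ord mulr_natl. Qed.

Lemma bsumN f n w : bsum (fun w => - f w) n w = - bsum f n w.
Proof. by rewrite /bsum sumrN. Qed.

Lemma bsumDf f g n w : bsum (fun w => f w + g w) n w = bsum f n w + bsum g n w.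
Proof. by rewrite /bsum big_split. Qed.

Lemma bsumZ k f n w : bsum (fun w => k * f w) n w = k * bsum f n w.
Proof. by rewrite /bsum mulr_sumr. Qed.

Lemma bsum_sum m (F : nat -> T -> R) n w :
  bsum (fun w => \sum_(j < m) F j w) n w = \sum_(j < m) bsum (F j) n w.
Proof. by rewrite /bsum exchange_big. Qed.

(* The orbit segment of length [n] is cut greedily into blocks of length at
   most [M] whose averages are at least [b]; only the last, incomplete block
   is lost. *)
Lemma bsum_cover (g : T -> R) (b c : R) (M : nat) :
  0 <= c -> (forall w, - c <= g w) ->
  (forall w, exists2 n, (0 < n <= M)%N & n%:R * b <= bsum g n w) ->
  forall n w, n%:R * b - M%:R * (c + `|b|) <= bsum g n w.
Proof.
move=> c0 gc H n; elim/ltn_ind: n => n IH w.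
have [k /andP[k0 kM] Hk] := H w.
have [kn|nk] := leqP k n.
  rewrite -(subnKC kn) bsumD natrD.
  have nkn : (n - k < n)%N by rewrite ltn_subrL k0 (leq_trans k0 kn).
  have := IH _ nkn (iter k theta w); lra.
(* Here [n < k <= M]: the sum is at least [- n * c], and [M * (c + |b|)] absorbs both [n * c] and
   [n * b]. *)
have : bsum (fun=> - c) n w <= bsum g n w by exact: bsum_le.
rewrite bsum_const; apply: le_trans.
have nM : n%:R <= M%:R :> R by rewrite ler_nat (leq_trans (ltnW nk)).
have := ler_norm b; have := normr_ge0 b; have : 0 <= n%:R :> R by [].
move: (n%:R) (M%:R) nM => x y xy; nra.
Qed.

End BirkhoffSum.

(** * Null sets and submodularity of a capacity *)

Section Capacity.
Context {d : measure_display} {T : measurableType d} {R : realType}.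
Variable V : set T -> R.
Hypothesis capV : is_capacity V.
Hypothesis contV : continuous_capacity V.
Hypothesis concV : concave_capacity V.

Lemma cap_ge0 A : measurable A -> 0 <= V A.
Proof. by case: capV => _ _ H _ /H /andP[]. Qed.

Lemma cap_le1 A : measurable A -> V A <= 1.
Proof. by case: capV => _ _ H _ /H /andP[]. Qed.

Lemma cap_le A B : measurable A -> measurable B -> A `<=` B -> V A <= V B.
Proof. by case: capV => _ _ _; exact. Qed.

Lemma capU_le A B : measurable A -> measurable B -> V (A `|` B) <= V A + V B.
Proof.
move=> mA mB; apply: le_trans (concV _ _ mA mB).
by rewrite lerDl cap_ge0//; exact: measurableI.
Qed.

Lemma null_sub A B : measurable A -> measurable B -> A `<=` B ->
  V B = 0 -> V A = 0.
Proof.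
by move=> mA mB AB B0; apply/le_anti; rewrite cap_ge0// andbT -B0 cap_le.
Qed.

(** Finite unions are null by subadditivity; continuity from below passes to the limit. *)
Lemma null_bigcup (A : nat -> set T) : (forall n, measurable (A n)) ->
  (forall n, V (A n) = 0) -> V (\bigcup_n A n) = 0.
Proof.
move=> mA A0; rewrite -bigcup_bigsetU_bigcup.
pose B n := \big[setU/set0]_(i < n.+1) A i.
have mB n : measurable (B n) by exact: bigsetU_measurable.
have B0 n : V (B n) = 0.
  apply/le_anti; rewrite cap_ge0// andbT.
  elim: n => [|n IH]; first by rewrite /B big_ord1 A0.
  rewrite /B big_ord_recr/=; apply: le_trans (capU_le _ _ (mB n) (mA _)) _.
  by rewrite A0 addr0.
have := contV.1 B mB; rewrite (_ : (fun n => V (B n)) = cst 0); last first.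
  by apply/funext => n; rewrite B0.
move=> cB; apply: (cvg_unique _ (cB _)) => //; last exact: cvg_cst.
by move=> n; rewrite /B [X in _ `<=` X]big_ord_recr/=; exact: subsetUl.
Qed.

Lemma quasi_surely_forall (P : nat -> T -> Prop) :
  (forall n, quasi_surely V (P n)) -> quasi_surely V (fun w => forall n, P n w).
Proof.
move=> /choice[N HN]; exists (\bigcup_n N n); split.
- by apply: bigcup_measurable => n _; case: (HN n).
- by apply: null_bigcup => n; case: (HN n).
- move=> w nw n; have [_ _] := HN n; apply => Nw; apply: nw; by exists n.
Qed.

(** As [V setT = 1], a null set is not the whole space. Bounds on quasi-sure constants can thus be
    read off at a single point. *)
Lemma quasi_surely_ex (P : T -> Prop) : quasi_surely V P -> exists w, P w.
Proof.
move=> [N [mN N0 NP]]; apply: contrapT => nP.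
have NT : N = setT.
  by apply/seteqP; split => // w _; apply: contrapT => /NP Pw; apply: nP; exists w.
case: capV => _ + _ _; rewrite -NT N0 => /esym/eqP.
by rewrite oner_eq0.
Qed.

Lemma quasi_surelyI (P Q : T -> Prop) :
  quasi_surely V P -> quasi_surely V Q -> quasi_surely V (fun w => P w /\ Q w).
Proof.
move=> qP qQ.
have [|N [mN N0 H]] := quasi_surely_forall (fun n => if n is 0 then P else Q).
  by case.
by exists N; split => // w /H PQ; split; [exact: (PQ 0%N)|exact: (PQ 1%N)].
Qed.

Section Count.
Variable E : nat -> set T.
Hypothesis mE : forall k, measurable (E k).

Let count_ge N j := [set w | (j <= \sum_(k < N) (w \in E k))%N].

Let count_ge0 N : count_ge N 0 = setT.
Proof. exact/seteqP. Qed.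

Let count_ge_nil j : count_ge 0 j.+1 = set0.
Proof. by apply/seteqP; split => // w; rewrite /count_ge/= big_ord0. Qed.

Let count_geS N j :
  count_ge N.+1 j.+1 = count_ge N j.+1 `|` (E N `&` count_ge N j).
Proof.
apply/seteqP; split => w; rewrite /count_ge/= big_ord_recr/=.
  case: (boolP (w \in E N)) => wE; last by rewrite addn0; left.
  by rewrite addn1 ltnS => jN; right; split => //; rewrite -inE.
case=> [jN|[wE jN]]; first exact: ltn_addr.
by rewrite (mem_set wE) addn1 ltnS.
Qed.

Let count_ge_sub N j : count_ge N j.+1 `<=` count_ge N j.
Proof. by move=> w; rewrite /count_ge/=; exact: ltnW. Qed.

Let mcount_ge N j : measurable (count_ge N j).
Proof.
elim: N j => [|N IH] [|j]; rewrite ?count_ge0 ?count_ge_nil//.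
by rewrite count_geS; apply: measurableU => //; exact: measurableI.
Qed.

(* Submodularity makes the sum of capacities decrease when the sets are
   replaced by the chain of level sets of their counting function. *)
Lemma sum_cap_levels N m :
  \sum_(j < m) V [set w | (j < \sum_(k < N) (w \in E k))%N]
    <= \sum_(k < N) V (E k).
Proof.
change (\sum_(j < m) V (count_ge N j.+1) <= \sum_(k < N) V (E k)).
elim: N m => [|N IH] m.
  rewrite big_ord0 big1// => j _; rewrite count_ge_nil.
  by case: capV.
pose e j := V (E N `&` count_ge N j).
have me j : measurable (E N `&` count_ge N j) by exact: measurableI.
(* Strengthened so that induction on [m] telescopes: submodularity bounds the growth of the level at
   [m] by [e m - e m.+1], starting from [e 0 = V (E N)]. *)
suff H : \sum_(j < m) V (count_ge N.+1 j.+1) <=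
    \sum_(j < m) V (count_ge N j.+1) + (V (E N) - e m).
  apply: le_trans H _; rewrite big_ord_recr/=; apply: lerD; first exact: IH.
  by rewrite lerBlDr lerDl; exact: cap_ge0.
elim: m {IH} => [|m IH].
  by rewrite !big_ord0 add0r /e count_ge0 setIT subrr.
rewrite !big_ord_recr/= [X in _ + V X]count_geS.
have := concV _ _ (mcount_ge N m.+1) (me m).
have -> : count_ge N m.+1 `&` (E N `&` count_ge N m) = E N `&` count_ge N m.+1.
  rewrite setICA; congr (_ `&` _); apply/seteqP; split => [w []//|w wm].
  by split => //; exact: count_ge_sub.
rewrite -/(e m) -/(e m.+1) => H; lra.
Qed.

(** This replaces integration of the pointwise bound. If [p] is the minimum of the counting
    function, the first [p] level sets are the whole space, of capacity 1, and [r <= p] because the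
    minimum is attained. *)
Lemma le_sum_cap N (r : R) :
  (forall w, r <= \sum_(k < N) \1_(E k) w) -> r <= \sum_(k < N) V (E k).
Proof.
move=> rE.
pose cnt w := (\sum_(k < N) (w \in E k))%N.
have [w0 _] : exists w : T, True.
  by apply: quasi_surely_ex; exists set0; split => //; case: capV.
pose P n := `[< exists w, cnt w = n >].
have exP : exists n, P n by exists (cnt w0); apply/asboolP; exists w0.
case: (ex_minnP exP) => p /asboolP[w wp] minp.
have rp : r <= p%:R.
  rewrite -wp /cnt natr_sum; apply: (le_trans (rE w)).
  by apply: ler_sum => k _; rewrite indicE.
apply: (le_trans rp); apply: le_trans (sum_cap_levels N p).
rewrite (eq_bigr (fun=> 1)) ?sumr_const ?card_ord// => j _.
rewrite (_ : [set _ | _] = setT); first by case: capV.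
apply/seteqP; split => // v _ /=; apply: (leq_trans (ltn_ord j)).
by apply: minp; apply/asboolP; exists v.
Qed.

End Count.

Lemma measurable_le_fun (f : T -> R) (c : R) :
  measurable_fun setT f -> measurable [set w | c <= f w].
Proof.
move=> mf; rewrite (_ : [set _ | _] = setT `&` f @^-1` `[c, +oo[%classic).
  exact: mf.
by apply/seteqP; split => w /=; rewrite in_itv/= andbT// => -[].
Qed.

Lemma measurable_lt_fun (f : T -> R) (c : R) :
  measurable_fun setT f -> measurable [set w | c < f w].
Proof.
move=> mf; rewrite (_ : [set _ | _] = setT `&` f @^-1` `]c, +oo[%classic).
  exact: mf.
by apply/seteqP; split => w /=; rewrite in_itv/= andbT// => -[].
Qed.

(** * Visit frequencies and the ergodic theorem *)

Section Dynamics.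
Variable theta : T -> T.
Hypothesis mtheta : measurable_fun setT theta.
Hypothesis presV : preserves V theta.
Hypothesis ergV : ergodic V theta.

Lemma measurable_iter k : measurable_fun setT (iter k theta).
Proof.
elim: k => [|k IH]; first exact: measurable_id.
exact: (measurableT_comp mtheta IH).
Qed.

Lemma measurable_preimage_iter k A : measurable A ->
  measurable (iter k theta @^-1` A).
Proof. by move=> mA; rewrite -[X in measurable X]setTI; exact: measurable_iter. Qed.

Lemma cap_preimage_iter k A : measurable A -> V (iter k theta @^-1` A) = V A.
Proof.
move=> mA; elim: k => [//|k IH].
rewrite -IH -(presV _ (measurable_preimage_iter k _ mA)); congr V.
by apply/seteqP; split => w /=; rewrite -iterSr.
Qed.

Lemma measurable_bsum (f : T -> R) n :
  measurable_fun setT f -> measurable_fun setT (bsum theta f n).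
Proof.
move=> mf; apply: measurable_sum => k.
exact: (measurableT_comp mf (measurable_iter k)).
Qed.

Definition often_set (f : T -> R) (b : R) : set T :=
  [set w | often (fun n => bsum theta f n w) b].

Lemma measurable_often_set (f : T -> R) (b : R) :
  measurable_fun setT f -> measurable (often_set f b).
Proof.
move=> mf.
(* Restricting the slack to the values [i.+1^-1] leaves only countable operations. *)
have -> : often_set f b = \bigcup_i \bigcap_m \bigcup_(n in [set n | (m <= n)%N])
    [set w | n%:R * (b + i.+1%:R^-1) <= bsum theta f n w].
  apply/seteqP; split => w.
    move=> [e e0 H]; have [i Hi] := nat_ge (e^-1).
    exists i => // m _; have [n mn Hn] := H m; exists n => //=.
    apply: le_trans Hn; rewrite ler_wpM2l// lerD2l -[e]invrK lef_pV2 ?posrE ?invr_gt0//.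
    by apply: (le_trans Hi); rewrite ler_nat.
  move=> [i _ H]; exists (i.+1%:R^-1); first by rewrite invr_gt0.
  by move=> m; have [n mn Hn] := H m I; exists n.
apply: bigcup_measurable => i _; apply: bigcap_measurable => // m _.
apply: bigcup_measurable => n _; apply: measurable_le_fun.
exact: measurable_bsum.
Qed.

Lemma often_set_invariant (f : T -> R) (b K : R) : (forall w, `|f w| <= K) ->
  theta @^-1` often_set f b = often_set f b.
Proof.
move=> fK; apply/seteqP; split => w; rewrite /often_set/=.
- apply: (@often_succ _ _ _ _ K) => n; rewrite bsumSl.
  by move: (fK w); rewrite ler_norml => /andP[]; lra.
- apply: (@often_pred _ _ _ _ K) => n; rewrite bsumSl.
  by move: (fK w); rewrite ler_norml => /andP[]; lra.
Qed.

Lemma often_set_dichotomy (f : T -> R) (b K : R) :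
  measurable_fun setT f -> (forall w, `|f w| <= K) ->
  V (often_set f b) = 0 \/ V (~` often_set f b) = 0.
Proof.
move=> mf fK; have [] := ergV _ (measurable_often_set f b mf) => //.
exact: often_set_invariant fK.
Qed.

(** The points at which no block for [bsum_cover] begins. *)
Definition late_set (f : T -> R) (b : R) (M : nat) : set T :=
  ~` \bigcup_(n in [set n | (0 < n <= M)%N]) [set w | n%:R * b <= bsum theta f n w].

Lemma measurable_late_set (f : T -> R) (b : R) M :
  measurable_fun setT f -> measurable (late_set f b M).
Proof.
move=> mf; apply: measurableC; apply: bigcup_measurable => n _.
by apply: measurable_le_fun; exact: measurable_bsum.
Qed.

(** The late sets decrease to a subset of a null set, so continuity from above applies. The index
    [M.+1] leaves room for the blocks of length one used on the late set itself. *)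
Lemma late_set_small (f : T -> R) (b e : R) : measurable_fun setT f ->
  V (~` often_set f b) = 0 -> 0 < e -> exists M, V (late_set f b M.+1) < e.
Proof.
move=> mf f0 e0.
have mD M := measurable_late_set f b M.+1 mf.
have := contV.2 (fun M => late_set f b M.+1) mD.
have -> : V (\bigcap_M late_set f b M.+1) = 0.
  apply: (null_sub _ _ _ _ _ f0).
  - exact: bigcap_measurable.
  - by apply: measurableC; exact: measurable_often_set.
  - move=> w Dw [e' e'0 /(_ 1%N)[[//|n] _ Hn]]; apply: (Dw n I).
    exists n.+1; first by rewrite /= ltnS leqnn.
    by apply: le_trans Hn; rewrite ler_wpM2l// lerDl ltW.
have Dmono M : late_set f b M.+2 `<=` late_set f b M.+1.
  move=> w Dw [n /andP[n0 nM] Hn]; apply: Dw.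
  by exists n => //=; rewrite n0 leqW.
move=> /(_ Dmono)/cvgrPdist_lt/(_ e e0)[M _ /(_ M (leqnn _))].
by rewrite /= sub0r normrN => H; exists M; exact: le_lt_trans (ler_norm _) H.
Qed.

Lemma often_set_indic A b : measurable A ->
  V (~` often_set (\1_A) b) = 0 -> b <= V A.
Proof.
move=> mA A0.
have [w [e e0 /(_ 1%N)[n0 n1]]] : exists w, often_set (\1_A) b w.
  apply: quasi_surely_ex; exists (~` often_set (\1_A) b); split => //.
    by apply: measurableC; exact: measurable_often_set.
  by move=> w; exact: contrapT.
move=> Hn0.
(* This lets one visit to [E] serve as a block of length one at the points of [D]. *)
have b1 : b <= 1.
  have : bsum theta (\1_A) n0 w <= n0%:R * 1 :> R.
    rewrite -(bsum_const theta 1 n0 w); apply: bsum_le => v.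
    by rewrite indicE lern1 leq_b1.
  move/(le_trans Hn0); rewrite ler_pM2l ?ltr0n//; lra.
apply/ler_addgt0Pr => e' e'0.
have [M HM] := late_set_small _ _ _ (measurable_indic mA) A0 e'0.
set D := late_set _ _ _ in HM.
have mD : measurable D by apply: measurable_late_set; exact: measurable_indic.
pose E := A `|` D; have mE : measurable E by exact: measurableU.
apply: (@le_trans _ _ (V E)); last first.
  by apply: le_trans (capU_le _ _ mA mD) _; rewrite lerD2l ltW.
have cover n v : n%:R * b - M.+1%:R * (0 + `|b|) <= bsum theta (\1_E) n v.
  apply: bsum_cover => // [u|u]; first by rewrite oppr0 indicE.
  have [Du|] := pselect (D u).
    exists 1%N => //; rewrite /bsum big_ord1/= indicE mem_set ?mul1r//.
    by right.
  move=> /contrapT[n' n'M Hn']; exists n' => //; apply: le_trans Hn' _.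
  apply: bsum_le => x; rewrite !indicE ler_nat.
  case: (boolP (x \in A)) => //; rewrite inE => Ax.
  by rewrite mem_set//; left.
(* All preimages of [E] have capacity [V E], so the pointwise bound becomes one on [V E]; the
   boundary term is negligible for large [n]. *)
have VE n : n%:R * b - M.+1%:R * `|b| <= n%:R * V E.
  have := @le_sum_cap (fun k => iter k theta @^-1` E)
    (fun k => measurable_preimage_iter k _ mE) n _ (cover n).
  rewrite add0r; under eq_bigr do rewrite cap_preimage_iter//.
  by rewrite sumr_const card_ord -[X in _ <= X -> _]mulr_natl.
rewrite leNgt; apply/negP => Eb.
have [n Hn] := nat_ge ((M.+1%:R * `|b| + 1) / (b - V E)).
have := VE n; move: Hn; rewrite ler_pdivrMr ?subr_gt0//; lra.
Qed.

(* The sets [D] on which the averages of [- f] are late have small capacity,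
   hence so do their visit frequencies, and [f] may be lowered on [D]. *)
Lemma limsup_le_liminf (f : T -> R) (a e K : R) :
  measurable_fun setT f -> (forall w, `|f w| <= K) -> 0 < e ->
  V (~` often_set (fun w => - f w) (- a)) = 0 -> V (often_set f (a + e)) = 0.
Proof.
move=> mf fK e0 H.
have mNf : measurable_fun setT (fun w => - f w) by exact: measurableT_comp.
have [w0 _] : exists w : T, True.
  by apply: quasi_surely_ex; exists set0; split => //; case: capV.
have K0 : 0 <= K by apply: le_trans (fK w0).
(* Large enough that [- f + k] is at least [- a], so each point of [D] is a block of length one. *)
pose k := K + `|a| + 1.
have k0 : 0 < k by rewrite ltr_wpDl// addr_ge0.
have [M HM] := late_set_small _ _ _ mNf H (divr_gt0 e0 k0).
set D := late_set _ _ _ in HM.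
have mD : measurable D by exact: measurable_late_set.
have cover n w : n%:R * (- a) - M.+1%:R * (K + `|- a|)
    <= bsum theta (fun w => - f w + k * \1_D w) n w.
  apply: bsum_cover => // [u|u].
    have : 0 <= k * \1_D u by rewrite mulr_ge0 ?(ltW k0)// indicE.
    by have := fK u; rewrite ler_norml => /andP[]; lra.
  have [Du|] := pselect (D u).
    exists 1%N => //; rewrite /bsum big_ord1/= indicE mem_set// mulr1 mul1r.
    have := ler_norm (- a); rewrite normrN /k.
    by have := fK u; rewrite ler_norml => /andP[]; lra.
  move=> /contrapT[n' n'M Hn']; exists n' => //; apply: le_trans Hn' _.
  by apply: bsum_le => x; rewrite lerDl mulr_ge0 ?(ltW k0)// indicE.
have mB : measurable (often_set (\1_D) (e / k)).
  by apply: measurable_often_set; exact: measurable_indic.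
(* By [cover], averages of [f] often above [a + e] force visits to [D] with upper frequency above
   [e / k], which exceeds [V D]. *)
apply: (null_sub _ _ _ mB) => [||].
- exact: measurable_often_set.
- move=> w; rewrite /often_set/=.
  apply: (@often_scale _ _ _ a e k (M.+1%:R * (K + `|- a|))) => // n.
  by have := cover n w; rewrite bsumDf bsumN bsumZ; lra.
- have [//|/(often_set_indic _ _ mD)] :=
    @often_set_dichotomy (\1_D) (e / k) 1 (measurable_indic mD)
      (fun w => ltac:(by rewrite indicE ger0_norm// lern1 leq_b1)).
  by rewrite leNgt HM.
Qed.

Definition averages_to (f : T -> R) (c : R) (w : T) : Prop :=
  (n%:R^-1 * bsum theta f n w) @[n --> \oo] --> c.

Lemma ergodic_theorem (f : T -> R) (K : R) : measurable_fun setT f -> (forall w, `|f w| <= K) ->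
  exists c, quasi_surely V (averages_to f c).
Proof.
move=> mf fK.
have mNf : measurable_fun setT (fun w => - f w) by exact: measurableT_comp.
have NfK w : `|- f w| <= K by rewrite normrN.
have lef w : f w <= K by rewrite (le_trans (ler_norm _)).
have gef w : - K <= f w by have := fK w; rewrite ler_norml => /andP[].
(* The levels that the limsup quasi-surely does not exceed; the infimum of [P] is the candidate
   limit. *)
pose P := [set b | V (often_set f b) = 0].
have P_mono b b' : b <= b' -> P b -> P b'.
  move=> bb'; apply: null_sub; [exact: measurable_often_set..|].
  by move=> w; exact: often_le.
have PK : P K.
  rewrite /P/= (_ : often_set f K = set0); first by case: capV.
  apply/seteqP; split => // w [e e0 /(_ 1%N)[n n1 Hn]].
  have := bsum_le theta f (fun=> K) n w lef; rewrite bsum_const.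
  move/(le_trans Hn); rewrite ler_pM2l ?ltr0n//; lra.
have nPK b : b < - K -> ~ P b.
  move=> bK; rewrite /P/= (_ : often_set f b = setT).
    by case: capV => _ -> _ _ /eqP; rewrite oner_eq0.
  apply/seteqP; split => // w _; exists (- K - b); first by rewrite subr_gt0.
  move=> m; exists m => //.
  rewrite [b + _]addrC subrK -(bsum_const theta _ m w).
  exact: bsum_le.
have infP : has_inf P.
  split; first by exists K.
  by exists (- K) => b Pb; rewrite leNgt; apply/negP => /nPK.
exists (inf P).
have Pgt e : 0 < e -> V (often_set f (inf P + e)) = 0.
  by move=> e0; have [b Pb /ltW bP] := inf_adherent e0 infP; exact: P_mono Pb.
have Plt e : 0 < e -> V (often_set (fun w => - f w) (- inf P + e)) = 0.
  move=> e0.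
  (* Otherwise the liminf is quasi-surely below [inf P - e], and [limsup_le_liminf] puts
     [inf P - e / 2] into [P]. *)
  have [//|] := often_set_dichotomy _ (- inf P + e) _ mNf NfK.
  rewrite (_ : - inf P + e = - (inf P - e)); last by rewrite opprB addrC.
  have e2 : 0 < e / 2 by rewrite divr_gt0.
  move=> HN; have Pe := limsup_le_liminf _ _ _ _ mf fK e2 HN.
  have := ge_inf infP.2 Pe; lra.
exists (\bigcup_k (often_set f (inf P + k.+1%:R^-1)
   `|` often_set (fun w => - f w) (- inf P + k.+1%:R^-1))); split.
- apply: bigcup_measurable => k _; apply: measurableU;
    exact: measurable_often_set.
- apply: null_bigcup => k.
    by apply: measurableU; exact: measurable_often_set.
  apply/le_anti; apply/andP; split; last first.
    by apply: cap_ge0; apply: measurableU; exact: measurable_often_set.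
  apply: le_trans (capU_le _ _ _ _) _; [exact: measurable_often_set..|].
  by rewrite Pgt ?Plt ?addr0.
- move=> w nw; rewrite /averages_to.
  have small (e : R) : 0 < e -> exists k : nat, k.+1%:R^-1 <= e.
    move=> e0; have [k Hk] := nat_ge (e^-1); exists k.
    rewrite -[e]invrK lef_pV2 ?posrE ?invr_gt0//.
    by apply: (le_trans Hk); rewrite ler_nat.
  apply: cvg_notoften => e /small[k ke].
  + move/(often_le _ _ _ (lerD (lexx _) ke)) => ow.
    by apply: nw; exists k => //; left.
  + move=> ow; apply: nw; exists k => //; right; rewrite /often_set/=.
    apply: (often_le _ _ _ (lerD (lexx _) ke)).
    by under eq_fun do rewrite bsumN.
Qed.

Lemma average_indic_le A c : measurable A ->
  quasi_surely V (averages_to (\1_A) c) -> c <= V A.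
Proof.
move=> mA [N [mN N0 Nc]]; rewrite leNgt; apply/negP => Ac.
pose b := (V A + c) / 2.
have bc : b < c by rewrite /b; lra.
have Ab : V A < b by rewrite /b; lra.
have NB : ~` often_set (\1_A) b `<=` N.
  by move=> w nw; apply: contrapT => /Nc /often_cvg /(_ bc).
have : V (~` often_set (\1_A) b) = 0.
  apply: null_sub NB N0 => //.
  by apply: measurableC; exact: measurable_often_set.
by move/(often_set_indic _ _ mA); rewrite leNgt Ab.
Qed.

Lemma average_le_riemann (f : T -> R) (c K : R) n : measurable_fun setT f ->
  0 < K -> (forall w, `|f w| <= K) -> (0 < n)%N ->
  quasi_surely V (averages_to f c) ->
  c <= - K + K / n%:R * \sum_(j < n + n) V [set w | - K + j%:R * (K / n%:R) < f w].
Proof.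
move=> mf K0 fK n0 qc.
set h := K / n%:R.
have h0 : 0 < h by rewrite divr_gt0// ltr0n.
pose A j := [set w | - K + j%:R * h < f w].
have mA j : measurable (A j) by exact: measurable_lt_fun.
have /choice[cc Hcc] : forall j, exists c', quasi_surely V (averages_to (\1_(A j)) c').
  move=> j; apply: (@ergodic_theorem _ 1); first exact: measurable_indic.
  by move=> w; rewrite indicE ger0_norm// lern1 leq_b1.
(* A single orbit along which the averages of [f] and of all the indicators converge. *)
have [w [wf wA]] := quasi_surely_ex _ (quasi_surelyI _ _ qc (quasi_surely_forall _ Hcc)).
apply: (@le_trans _ _ (- K + h * \sum_(j < n + n) cc j)); last first.
  rewrite lerD2l ler_wpM2l ?(ltW h0)//; apply: ler_sum => j _.
  exact: average_indic_le (Hcc j).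
have pointwise v : f v <= - K + h * \sum_(j < n + n) \1_(A j) v.
  (* Truncating at the [m]-th level permits induction on [m]; the last level is [K], where the
     truncation has no effect. *)
  have : forall m, Num.min (f v) (- K + m%:R * h) <= - K + h * \sum_(j < m) \1_(A j) v.
    elim=> [|m IH]; first by rewrite big_ord0 mul0r mulr0 ge_min lexx orbT.
    rewrite big_ord_recr/= indicE mulrDr.
    have [Am|nAm] := ltP (- K + m%:R * h) (f v).
      rewrite (mem_set (Am : A m v)) mulr1.
      apply: (@le_trans _ _ (- K + m.+1%:R * h)); first by rewrite ge_min lexx orbT.
      by move: IH; rewrite min_r ?(ltW Am)// -(natr1 m); lra.
    rewrite memNset ?mulr0 ?addr0; last by rewrite /A/=; apply/negP; rewrite -leNgt.
    by move: IH; rewrite (min_l nAm); apply: le_trans; rewrite ge_min lexx.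
  move=> /(_ (n + n)%N); rewrite min_l// natrD mulrDl.
  have -> : n%:R * h = K by rewrite /h mulrC divfK// pnatr_eq0 -lt0n.
  by rewrite addKr (le_trans (ler_norm _)).
have cs : (\sum_(j < n + n) (n'%:R^-1 * bsum theta (\1_(A j)) n' w))
    @[n' --> \oo] --> \sum_(j < n + n) cc j.
  by apply: cvg_big => [|j _]; [exact: add_continuous|exact: wA].
have lim_right : (- K + h * \sum_(j < n + n) (m%:R^-1 * bsum theta (\1_(A j)) m w))
    @[m --> \oo] --> - K + h * \sum_(j < n + n) cc j.
  by apply: cvgD; [exact: cvg_cst|exact: cvgMl_tmp].
apply: (ler_cvg_to (wf : _ --> _) lim_right).
exists 1%N => // m /= m0; have mR : 0 < m%:R :> R by rewrite ltr0n.
rewrite -mulr_sumr mulrCA -[X in X + _](mulKf (lt0r_neq0 mR)) -mulrDr.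
rewrite ler_wpM2l ?invr_ge0//; apply: le_trans (bsum_le _ _ _ _ _ pointwise) _.
by rewrite bsumDf bsum_const bsumZ (bsum_sum _ _ (fun j => \1_(A j))).
Qed.

End Dynamics.
End Capacity.

(** * Comparison of the limit with the two Choquet integrals *)

Theorem theorem7 (d : measure_display) (T : measurableType d) (R : realType)
  (V : set T -> R) (theta : T -> T) (xi : T -> R) :
  is_capacity V -> continuous_capacity V -> concave_capacity V ->
  measurable_fun setT theta -> preserves V theta -> ergodic V theta ->
  measurable_fun setT xi -> (exists M : R, forall w, `|xi w| <= M) ->
  exists c : R,
    quasi_surely V (fun w =>
      (n%:R^-1 * \sum_(k < n) xi (iter k theta w)) @[n --> \oo] --> c) /\
    (choquet (conjugate V) xi <= c%:E)%E /\ (c%:E <= choquet V xi)%E.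
Proof.
move=> capV contV concV mtheta presV ergV mxi [M xiM].
have [c qc] := ergodic_theorem _ capV contV concV _ mtheta presV ergV _ _ mxi xiM.
exists c; split; first exact: qc.
(* The added 1 makes [K] positive and the bound on [xi] strict, so that [{xi >= K}] is already
   empty. *)
pose K := Num.max M 0 + 1.
have K0 : 0 < K by rewrite ltr_wpDl// le_max lexx orbT.
have xiK w : `|xi w| < K.
  by rewrite (le_lt_trans (xiM w))// ltr_pwDr// le_max lexx.
have mge t : measurable [set w | t <= xi w] by exact: measurable_le_fun.
have ge_sub s t : s <= t -> [set w | t <= xi w] `<=` [set w | s <= xi w].
  by move=> st w /=; exact: le_trans.
have ge_low t : t <= - K -> [set w | t <= xi w] = setT.
  move=> tK; apply/seteqP; split => // w _ /=; apply: (le_trans tK).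
  by have := xiK w; rewrite ltr_norml => /andP[/ltW].
have ge_high t : K <= t -> [set w | t <= xi w] = set0.
  move=> Kt; apply/seteqP; split => // w /= tx.
  by have := le_lt_trans (le_trans Kt tx) (le_lt_trans (ler_norm _) (xiK w)); rewrite ltxx.
have [V0 V1 _ _] := capV.
have small e : 0 < e -> exists2 n, (0 < n)%N & K / n%:R <= e.
  move=> e0; have [n Hn] := nat_ge (K / e); exists n.+1 => //.
  rewrite ler_pdivrMr ?ltr0n// mulrC -ler_pdivrMr//; apply: (le_trans Hn).
  by rewrite ler_nat.
(* Left and right sums of a function going from 1 to 0 differ by 1, hence by [h] after scaling; a
   mesh of at most [e] then suffices. *)
have telescope (g : R -> R) n (h := K / n%:R) : (0 < n)%N -> g (- K) = 1 ->
    g K = 0 -> \sum_(j < n + n) g (- K + j%:R * h)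
      = \sum_(j < n + n) g (- K + j.+1%:R * h) + 1.
  move=> n0 gK0 gK1.
  have -> : \sum_(j < n + n) g (- K + j%:R * h)
      = \sum_(j < (n + n).+1) g (- K + j%:R * h).
    rewrite big_ord_recr/= natrD mulrDl.
    have -> : n%:R * h = K by rewrite /h mulrC divfK// pnatr_eq0 -lt0n.
    by rewrite addKr gK1 addr0.
  by rewrite big_ord_recl/= mul0r addr0 gK0 addrC.
split.
- pose v t := conjugate V [set w | t <= xi w].
  have v_low t : t <= - K -> v t = 1.
    by move=> /ge_low; rewrite /v /conjugate => ->; rewrite setCT V0 subr0.
  have v_high t : K <= t -> v t = 0.
    by move=> /ge_high; rewrite /v /conjugate => ->; rewrite setC0 V1 subrr.
  have mC t : measurable (~` [set w | t <= xi w]) by exact: measurableC.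
  have v_mono : {homo v : s t /~ t <= s}.
    move=> s t st; rewrite /v /conjugate lerD2l lerN2 cap_le//.
    by apply: subsetC; exact: ge_sub.
  have v01 t : 0 <= v t <= 1.
    rewrite /v /conjugate subr_ge0 lerBlDr lerDl.
    by rewrite cap_ge0// (cap_le1 _ capV).
  apply/lee_addgt0Pr => e /small[n n0 ne].
  apply: le_trans
    (choquet_le_riemann (conjugate V) xi _ _ K0 n0 v_mono v01 v_high) _.
  rewrite -EFinD lee_fin.
  have mN : measurable_fun setT (fun w => - xi w) by exact: measurableT_comp.
  have NK w : `|- xi w| <= K by rewrite normrN ltW.
  have qN : quasi_surely V (averages_to theta (fun w => - xi w) (- c)).
    have [N [mN' N0 Nc]] := qc; exists N; split => // w /Nc wc.
    by rewrite /averages_to; under eq_fun do rewrite bsumN mulrN; exact: cvgN wc.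
  have := average_le_riemann _ capV contV concV _ mtheta presV ergV
    _ _ _ _ mN K0 NK n0 qN.
  rewrite -/(v _); set h := K / n%:R in ne *.
  have -> : \sum_(j < n + n) V [set w | - K + j%:R * h < - xi w]
      = (n + n)%:R - \sum_(j < n + n) v (- K + j.+1%:R * h).
    (* Reversing the grid turns [{- xi > - t}] into [{xi < t}], whose capacity is [1 - v t], at the
       right endpoints [t]. *)
    rewrite (reindex_inj rev_ord_inj)/= -[X in X - _]mulr1 mulr_natl.
    rewrite -[X in _ *+ X - _]card_ord -sumr_const -sumrB; apply: eq_bigr => j _.
    rewrite /v /conjugate subKr; congr V.
    have -> : - K + (n + n - j.+1)%:R * h = - (- K + j.+1%:R * h).
      rewrite natrB// natrD mulrBl mulrDl.
      have -> : n%:R * h = K by rewrite /h mulrC divfK// pnatr_eq0 -lt0n.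
      by ring.
    by apply/seteqP; split => w /=; rewrite ltrN2 ltNge => /negP.
  rewrite (telescope v n n0 (v_low _ (lexx _)) (v_high _ (lexx _))) natrD mulrBr !mulrDr mulr1.
  have -> : h * n%:R = K by rewrite /h divfK// pnatr_eq0 -lt0n.
  by rewrite /h in ne *; lra.
- pose g t := V [set w | t <= xi w].
  have g_low t : t <= - K -> g t = 1 by move=> /ge_low; rewrite /g => ->.
  have g_high t : K <= t -> g t = 0 by move=> /ge_high; rewrite /g => ->.
  have g_mono : {homo g : s t /~ t <= s}.
    by move=> s t st; apply: cap_le => //; exact: ge_sub.
  have g01 t : 0 <= g t <= 1 by rewrite /g cap_ge0// (cap_le1 _ capV).
  apply/lee_addgt0Pr => e /small[n n0 ne].
  apply: le_trans (leeD2r _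
    (riemann_le_choquet V xi _ _ K0 n0 g_mono g01 g_low)).
  rewrite -EFinD lee_fin.
  have xK w : `|xi w| <= K by exact: ltW.
  have := average_le_riemann _ capV contV concV _ mtheta presV ergV
    _ _ _ _ mxi K0 xK n0 qc.
  (* Passing from strict to weak level sets gives the left sum of [g], one mesh above the right sum
     that minorises the integral. *)
  have : \sum_(j < n + n) V [set w | - K + j%:R * (K / n%:R) < xi w]
      <= \sum_(j < n + n) g (- K + j%:R * (K / n%:R)).
    apply: ler_sum => j _; apply: cap_le => //.
      exact: measurable_lt_fun.
    by move=> w /=; exact: ltW.
  have h0 : 0 < K / n%:R by rewrite divr_gt0// ltr0n.
  rewrite (telescope g n n0 (g_low _ (lexx _)) (g_high _ (lexx _))).
  move: (K / n%:R) h0 ne => h h0 ne; rewrite -(ler_pM2l h0) mulrDr mulr1; lra.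
Qed.
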